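(* Let $w=w_1w_2w_3\cdots$ be an infinite word with letters in $\{0,1,2\}$ of the form $w=[w]_{k_0}000\cdots$, i.e. $w_j=0$ for all $j>k_0$. Suppose that $u$ is a function on the Sierpinski Gasket $SG$ with $(\Delta+\lambda)u=0$, and that $m_0$ is chosen large enough that the spectral decimation formula (stated in the context) holds for $u$ with a sequence $\{\lambda_m\}_{m\ge m_0}$ associated to $\lambda$ satisfying $\lambda_m\neq 2,5,6$ when $m>m_0$. If $k=\max\{k_0,m_0\}$ then $$T_wu=\Bigl(A_{w_1}^{-1}\cdots A_{w_k}^{-1}\Bigr)\,M_0(\lambda,k)\,A_{w_k}(\lambda_k)\cdots A_{w_{m_0+1}}(\lambda_{m_0+1})\;u\big|_{F_{w_1\cdots w_{m_0}}(V_0)},$$ where $$M_0(\lambda,k)=\begin{pmatrix}1&0&0\\[4pt] 1-\frac{(4-\lambda_k)\lambda\tau_k(\lambda)}{3\cdot5^k\lambda_k}&\frac{\lambda(2\tau_k(\lambda)+1)}{3\cdot5^k\lambda_k}&\frac{\lambda(2\tau_k(\lambda)-1)}{3\cdot5^k\lambda_k}\\[4pt] 1-\frac{(4-\lambda_k)\lambda\tau_k(\lambda)}{3\cdot5^k\lambda_k}&\frac{\lambda(2\tau_k(\lambda)-1)}{3\cdot5^k\lambda_k}&\frac{\lambda(2\tau_k(\lambda)+1)}{3\cdot5^k\lambda_k}\end{pmatrix}$$ and $$\tau_k(\lambda)=\frac{1}{2-\lambda_{k+1}}\prod_{j=2}^\infty\Bigl(1-\frac{\lambda_{k+j}}{3}\Bigr).$$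 (Empty products of matrices are the identity; in particular $A_{w_k}(\lambda_k)\cdots A_{w_{m_0+1}}(\lambda_{m_0+1})$ is the identity when $k=m_0$.)
   Context: **Sierpinski Gasket.** Let $q_0,q_1,q_2\in\mathbb{R}^2$ be the vertices of an equilateral triangle, $F_i(x)=(x+q_i)/2$ for $i=0,1,2$, and let $SG$ be the unique nonempty compact set with $SG=\bigcup_i F_i(SG)$. For a word $w=w_1\cdots w_m$ with letters in $\{0,1,2\}$ put $F_w=F_{w_1}\circ\cdots\circ F_{w_m}$ (the identity for the empty word); $F_w(SG)$ is called an $m$-cell. Let $V_0=\{q_0,q_1,q_2\}$ (the boundary), $V_m=\{F_w(q_i): |w|=m,\ i=0,1,2\}$, $V_*=\bigcup_m V_m$. For distinct $x,y\in V_m$ write $x\sim_m y$ if $x,y$ belong to a common $m$-cell. **Laplacian.** For $x\in V_m\setminus V_0$ let $\Delta_m u(x)=\sum_{y\sim_m x}(u(y)-u(x))$. A continuous function $u$ on $SG$ is in $\operatorname{dom}(\Delta)$ if $\frac32 5^m\Delta_m u(x)$ converges as $m\to\infty$ uniformly on $V_*\setminus V_0$ to a continuous function; then $\Delta u$ is this limit, extended to $SG$ by continuity. The equation $(\Delta+\lambda)u=0$ includes the requirement $u\in\operatorname{dom}(\Delta)$. A function $h$ is harmonic if $\Delta h=0$; harmonic functions are uniquely determined by, and identified with, their vector of values $(h(q_0),h(q_1),h(q_2))^T$ on $V_0$, which may be arbitrary. **Vectors of values.** For a finite word $v$, $u|_{F_v(V_0)}$ denotes the column vector $(u(F_v(q_0)),u(F_v(q_1)),u(F_v(q_2)))^T$.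 **Matrices.** For $\mu\neq2,5$ define $$A_0(\mu)=\tfrac{1}{(5-\mu)(2-\mu)}\begin{pmatrix}(5-\mu)(2-\mu)&0&0\\4-\mu&4-\mu&2\\4-\mu&2&4-\mu\end{pmatrix},$$ $$A_1(\mu)=\tfrac{1}{(5-\mu)(2-\mu)}\begin{pmatrix}4-\mu&4-\mu&2\\0&(5-\mu)(2-\mu)&0\\2&4-\mu&4-\mu\end{pmatrix},$$ $$A_2(\mu)=\tfrac{1}{(5-\mu)(2-\mu)}\begin{pmatrix}4-\mu&2&4-\mu\\2&4-\mu&4-\mu\\0&0&(5-\mu)(2-\mu)\end{pmatrix},$$ and $A_i=A_i(0)$. The matrices $A_i$ are invertible and are the harmonic extension matrices: $h|_{F_i(V_0)}=A_i\,h|_{V_0}$ for harmonic $h$, so $h|_{F_v(V_0)}=A_{v_m}\cdots A_{v_1}h|_{V_0}$ for a word $v=v_1\cdots v_m$. **Spectral decimation formula.** A sequence $\{\lambda_m\}_{m\ge m_0}$ is associated to $\lambda$ if $\lambda_m(5-\lambda_m)=\lambda_{m-1}$ for $m>m_0$ and $\lambda=\frac32\lim_{m\to\infty}5^m\lambda_m$. The spectral decimation formula holds for $u$ (from level $m_0$, with this sequence) if for every $m>m_0$ and every word $v=v_1\cdots v_m$, $$u|_{F_v(V_0)}=A_{v_m}(\lambda_m)A_{v_{m-1}}(\lambda_{m-1})\cdots A_{v_{m_0+1}}(\lambda_{m_0+1})\,u|_{F_{v_1\cdots v_{m_0}}(V_0)}.$$ **Harmonic tangent.** For an infinite word $w=w_1w_2\cdots$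 let $[w]_m=w_1\cdots w_m$. Let $H_{[w]_m}u$ be the harmonic function on $SG$ coinciding with $u$ on $F_{[w]_m}(V_0)$; as a vector of boundary values, $H_{[w]_m}u=A_{w_1}^{-1}\cdots A_{w_m}^{-1}u|_{F_{[w]_m}(V_0)}$. The harmonic tangent of $u$ at $w$ is $T_wu=\lim_{m\to\infty}H_{[w]_m}u$ if the limit exists, regarded as a vector of values on $V_0$. *)

(* Defs.v *)
From HB Require Import structures.
From mathcomp Require Import all_boot all_order all_algebra.
From mathcomp Require Import all_classical all_reals all_analysis.

Set Implicit Arguments.
Unset Strict Implicit.
Unset Printing Implicit Defensive.

Import Order.TTheory GRing.Theory Num.Theory.
Import numFieldNormedType.Exports.

Local Open Scope classical_set_scope.
Local Open Scope ring_scope.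

(* The norm carried by 'rV[R]_2 is the sup norm, so Euclidean distances are
   written out. *)
Definition equilateral (R : realType) (q : 'I_3 -> 'rV[R]_2) : Prop :=
  exists2 d : R, 0 < d &
    forall i j : 'I_3, i != j ->
      \sum_(c < 2) (q i ord0 c - q j ord0 c) ^+ 2 = d.

Definition F (R : realType) (q : 'I_3 -> 'rV[R]_2) (i : 'I_3) (x : 'rV[R]_2)
    : 'rV[R]_2 :=
  2^-1 *: (x + q i).

Definition Fw (R : realType) (q : 'I_3 -> 'rV[R]_2) (w : seq 'I_3)
    (x : 'rV[R]_2) : 'rV[R]_2 :=
  foldr (F q) x w.

(* This characterizes the gasket: it is the unique such set. *)
Definition is_SG (R : realType) (q : 'I_3 -> 'rV[R]_2) (SG : set 'rV[R]_2)
    : Prop :=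
  [/\ SG !=set0, compact SG & SG = \bigcup_(i in [set: 'I_3]) (F q i @` SG)].

Definition V (R : realType) (q : 'I_3 -> 'rV[R]_2) (m : nat)
    : set 'rV[R]_2 :=
  [set x | exists w : seq 'I_3, size w = m /\ exists i, x = Fw q w (q i)].

Definition adjacent (R : realType) (q : 'I_3 -> 'rV[R]_2)
    (SG : set 'rV[R]_2) (m : nat) (x y : 'rV[R]_2) : Prop :=
  [/\ x <> y, V q m x, V q m y &
    exists w : seq 'I_3,
      [/\ size w = m, (Fw q w @` SG) x & (Fw q w @` SG) y]].

(* Functions on SG are represented by functions on the plane, of which only
   the values on SG are ever used. *)
Definition graph_laplacian (R : realType) (q : 'I_3 -> 'rV[R]_2)
    (SG : set 'rV[R]_2) (m : nat) (u : 'rV[R]_2 -> R) (x : 'rV[R]_2) : R :=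
  \sum_(y \in [set y | adjacent q SG m x y]) (u y - u x).

(* u is in dom(Delta) and Delta u = f on SG.  At level m the graph Laplacian
   makes sense on V_m \ V_0 only, so the uniform convergence on V_* \ V_0 is
   that of functions with increasing domains V_m \ V_0. As V_* \ V_0 is dense
   in SG, f is determined on SG by u. *)
Definition is_laplacian (R : realType) (q : 'I_3 -> 'rV[R]_2)
    (SG : set 'rV[R]_2) (u f : 'rV[R]_2 -> R) : Prop :=
  [/\ {within SG, continuous u}, {within SG, continuous f} &
    forall e : R, 0 < e ->
      exists N : nat, forall m : nat, (N <= m)%N ->
        forall x, (V q m `\` V q 0) x ->
          `|3 / 2 * 5 ^+ m * graph_laplacian q SG m u x - f x| < e].

(* (Delta + lambda) u = 0 *)
Definition eigen_equation (R : realType) (q : 'I_3 -> 'rV[R]_2)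
    (SG : set 'rV[R]_2) (lambda : R) (u : 'rV[R]_2 -> R) : Prop :=
  exists2 f, is_laplacian q SG u f & forall x, SG x -> f x + lambda * u x = 0.

Definition harmonic (R : realType) (q : 'I_3 -> 'rV[R]_2)
    (SG : set 'rV[R]_2) (h : 'rV[R]_2 -> R) : Prop :=
  exists2 f, is_laplacian q SG h f & forall x, SG x -> f x = 0.

(* u|_{F_v(V_0)}; for v = [::] these are the boundary values. *)
Definition values (R : realType) (q : 'I_3 -> 'rV[R]_2) (u : 'rV[R]_2 -> R)
    (v : seq 'I_3) : 'cV[R]_3 :=
  \col_i u (Fw q v (q i)).

Definition mx3 (R : realType) (rows : seq (seq R)) : 'M[R]_3 :=
  \matrix_(i, j) nth 0 (nth [::] rows i) j.

Definition A (R : realType) (mu : R) (i : 'I_3) : 'M[R]_3 :=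
  let d := (5 - mu) * (2 - mu) in
  let a := 4 - mu in
  d^-1 *: mx3 (nth [::]
    [:: [:: [:: d; 0; 0]; [:: a; a; 2]; [:: a; 2; a]];
        [:: [:: a; a; 2]; [:: 0; d; 0]; [:: 2; a; a]];
        [:: [:: a; 2; a]; [:: 2; a; a]; [:: 0; 0; d]]] i).

(* Letters of words are numbered from 0: the j-th letter w_j of an infinite
   word w is [w j.-1], and [w]_m is [mkseq w m]. *)

(* A_{w_m}(lambda_m) ... A_{w_{m0+1}}(lambda_{m0+1}), the identity when
   m <= m0; the highest index is the leftmost factor. *)
Definition decimation_product (R : realType) (lam : nat -> R)
    (w : nat -> 'I_3) (m0 m : nat) : 'M[R]_3 :=
  \prod_(j <- rev (index_iota m0 m)) A (lam j.+1) (w j).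

(* Only the terms lam m with m0 <= m matter. *)
Definition associated (R : realType) (m0 : nat) (lam : nat -> R) (lambda : R)
    : Prop :=
  (forall m, (m0 < m)%N -> lam m * (5 - lam m) = lam m.-1) /\
  (fun m => 3 / 2 * (5 ^+ m * lam m)) @ \oo --> lambda.

Definition spectral_decimation (R : realType) (q : 'I_3 -> 'rV[R]_2)
    (m0 : nat) (lam : nat -> R) (u : 'rV[R]_2 -> R) : Prop :=
  forall m, (m0 < m)%N -> forall v : seq 'I_3, size v = m ->
    values q u v =
    decimation_product lam (nth ord0 v) m0 m *m values q u (take m0 v).

(* T_w u exists and has boundary values T; H m is the harmonic function
   H_{[w]_m} u, whose values on V_0 are uniquely determined. *)
Definition is_harmonic_tangent (R : realType) (q : 'I_3 -> 'rV[R]_2)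
    (SG : set 'rV[R]_2) (u : 'rV[R]_2 -> R) (w : nat -> 'I_3) (T : 'cV[R]_3)
    : Prop :=
  exists H : nat -> 'rV[R]_2 -> R,
    (forall m, harmonic q SG (H m) /\
      forall i, H m (Fw q (mkseq w m) (q i)) = u (Fw q (mkseq w m) (q i))) /\
    (fun m => values q (H m) [::]) @ \oo --> T.

Definition tau (R : realType) (lam : nat -> R) (k : nat) : R :=
  (2 - lam k.+1)^-1 *
  limn (fun n => \prod_(2 <= j < n) (1 - lam (k + j)%N / 3)).

Definition M0 (R : realType) (lambda : R) (lam : nat -> R) (k : nat)
    : 'M[R]_3 :=
  let t := tau lam k in
  let d := 3 * 5 ^+ k * lam k in
  let a := 1 - (4 - lam k) * lambda * t / d in
  let b := lambda * (2 * t + 1) / d in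
  let c := lambda * (2 * t - 1) / d in
  mx3 [:: [:: 1; 0; 0]; [:: a; b; c]; [:: a; c; b]].

(* Main.v *)
Require Import Defs.
From HB Require Import structures.
From mathcomp Require Import all_boot all_order all_algebra.
From mathcomp Require Import all_classical all_reals all_analysis.
From mathcomp Require Import ring lra.

(* Beyond level k the word is constant, so T_w u is governed by the limit of
   A_0^{-n} A_0(lambda_{k+n}) ... A_0(lambda_{k+1}).  All these factors respect
   the symmetry exchanging q_1 and q_2, so that the product reduces to scalars:
   on the skew vector (0, 1, -1) it is 5^n prod 1/(5 - lambda_j), which is
   5^n lambda_{k+n} / lambda_k; on (0, 1, 1) it is this number times
   3^{-n} prod (6 - lambda_j)/(2 - lambda_j), and the identity
   6 - lambda_{j-1} = (2 - lambda_j)(3 - lambda_j) telescopes the latter to the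
   product defining tau_k; the vector (1, 1 - lambda_k/4, 1 - lambda_k/4) is
   sent to vectors that A_0^{-n} moves to (1, 1, 1) in the limit.

   The harmonic functions H_{[w]_m} u must also be produced.  The value at x of
   the harmonic function with boundary values B is the limit of the vectors
   A_{v_n} ... A_{v_1} B along an address v of x, since A_i shrinks oscillations
   by 3/5.  The cells F_i(SG) and F_j(SG) meet only at F_i(q_j), as one reads
   off from barycentric coordinates, so this value does not depend on the
   address, and the graph Laplacians can be computed by induction on the level. *)

Set Implicit Arguments.
Unset Strict Implicit.
Unset Printing Implicit Defensive.

Import Order.TTheory GRing.Theory Num.Theory.
Import numFieldNormedType.Exports.

Local Open Scope classical_set_scope.
Local Open Scope ring_scope.

(** * Entrywise matrix limits; sequences and products with geometric bounds *)

Lemma mx_cvg (R : realType) (m n : nat) (u : nat -> 'M[R]_(m, n))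
    (L : 'M[R]_(m, n)) :
  (forall i j, (fun t => u t i j) @ \oo --> L i j) -> u @ \oo --> L.
Proof.
move=> uL S [B LB sBS].
have : \forall t \near \oo, forall ij : 'I_m * 'I_n, B ij.1 ij.2 (u t ij.1 ij.2).
  by apply: filter_forall => -[i j]; exact: (uL i j _ (LB i j)).
by apply: filterS => t Bt; apply: sBS => i j; exact: (Bt (i, j)).
Qed.

Lemma cvg_mulmx (R : realType) (m n p : nat) (u : nat -> 'M[R]_(m, n))
    (v : nat -> 'M[R]_(n, p)) (L : 'M[R]_(m, n)) (K : 'M[R]_(n, p)) :
  u @ \oo --> L -> v @ \oo --> K -> (fun t => u t *m v t) @ \oo --> L *m K.
Proof.
move=> uL vK; apply: mx_cvg => i j.
have -> : (fun t => (u t *m v t) i j) = (fun t => \sum_l u t i l * v t l j).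
  by apply/funext => t; rewrite mxE.
rewrite mxE; apply: cvg_big; first exact: add_continuous.
move=> l _; apply: cvgM.
  apply: (@cvg_comp _ _ _ u (fun M : 'M[R]_(m, n) => M i l) _ _ _ uL).
  exact: coord_continuous.
apply: (@cvg_comp _ _ _ v (fun M : 'M[R]_(n, p) => M l j) _ _ _ vK).
exact: coord_continuous.
Qed.

Lemma geometric_increments_cvg (R : realType) (u : nat -> R) (C r : R) :
  0 <= r -> r < 1 -> (forall n, `|u n.+1 - u n| <= C * r ^+ n) -> cvgn u.
Proof.
move=> r0 r1 hu.
have C0 : 0 <= C.
  by have := hu 0%N; rewrite expr0 mulr1; apply: le_trans.
have hs : cvgn (series (fun n => u n.+1 - u n)).
  apply: normed_cvg; apply: (series_le_cvg _ _ hu) => [n//|n|].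
    by rewrite mulr_ge0// exprn_ge0.
  by apply: is_cvg_geometric_series; rewrite ger0_norm.
have -> : u = (fun n => series (fun n => u n.+1 - u n) n + u 0%N).
  by apply/funext => n; rewrite seriesEnat/= telescope_sumr ?subrK.
by apply: is_cvgD => //; exact: is_cvg_cst.
Qed.

Lemma geometric_increments_bound (R : realType) (u : nat -> R) (C r : R) n :
  0 <= r -> r < 1 -> (forall n, `|u n.+1 - u n| <= C * r ^+ n) ->
  `|u n - u 0%N| <= C / (1 - r).
Proof.
move=> r0 r1 hu.
have C0 : 0 <= C.
  by have := hu 0%N; rewrite expr0 mulr1; apply: le_trans.
have r1' : 0 < 1 - r by rewrite subr_gt0.
(* The exact partial sum of the geometric series, rather than its limit, lets the induction
   close. *)
have : `|u n - u 0%N| <= C * (1 - r ^+ n) / (1 - r).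
  elim: n => [|n IHn]; first by rewrite subrr normr0 expr0 subrr mulr0 mul0r.
  rewrite -(subrKA (u n)) (le_trans (ler_normD _ _))//.
  apply: (le_trans (lerD (hu n) IHn)).
  rewrite exprS le_eqVlt; apply/orP; left; apply/eqP; field.
  by rewrite gt_eqF.
move=> /le_trans; apply; rewrite ler_pM2r ?invr_gt0//.
by rewrite ler_piMr// gerBl exprn_ge0.
Qed.

(** Since 1 + x <= exp x, the partial products are bounded by the exponential of a geometric sum;
    consecutive ones then differ by at most a constant times [r ^+ n]. *)
Lemma geometric_prod_cvg (R : realType) (a : nat -> R) (C r : R) :
  0 <= r -> r < 1 -> (forall n, `|a n| <= C * r ^+ n) ->
  cvgn (fun n => \prod_(0 <= j < n) (1 - a j)).
Proof.
move=> r0 r1 ha.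
have C0 : 0 <= C.
  by have := ha 0%N; rewrite expr0 mulr1; apply: le_trans.
have r1' : 0 < 1 - r by rewrite subr_gt0.
have Pb n : `|\prod_(0 <= j < n) (1 - a j)| <= expR (C / (1 - r)).
  have : `|\prod_(0 <= j < n) (1 - a j)| <= expR (C * (1 - r ^+ n) / (1 - r)).
    elim: n => [|n IHn].
      by rewrite big_geq// normr1 expr0 subrr mulr0 mul0r expR0.
    rewrite big_nat_recr//= normrM.
    have -> : C * (1 - r ^+ n.+1) / (1 - r) =
              C * (1 - r ^+ n) / (1 - r) + C * r ^+ n.
      by rewrite exprS; field; rewrite gt_eqF.
    rewrite expRD ler_pM//.
    apply: (le_trans (ler_normB _ _)); rewrite normr1.
    by apply: (le_trans _ (expR_ge1Dx _)); rewrite lerD2l.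
  move=> /le_trans; apply; rewrite ler_expR ler_pM2r ?invr_gt0//.
  by rewrite ler_piMr// gerBl exprn_ge0.
apply: (@geometric_increments_cvg _ _ (expR (C / (1 - r)) * C) r) => // n.
rewrite big_nat_recr//= mulrBr mulr1 addrC addKr normrN normrM -mulrA.
by apply: ler_pM.
Qed.

(** * Matrices commuting with the exchange of q_1 and q_2 *)

Definition symmx (R : realType) (x s t : R) : 'M[R]_3 :=
  mx3 [:: [:: 1; 0; 0]; [:: x; (s + t) / 2; (s - t) / 2];
          [:: x; (s - t) / 2; (s + t) / 2]].

(** The vectors (0, 1, 1) and (0, 1, -1) are eigenvectors with eigenvalues [s] and [t], and (1, p,
    p) goes to (1, x + s p, x + s p), so [x] and [s] compose as in affine maps. *)
Lemma mulmx_symmx (R : realType) (x s t x' s' t' : R) :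
  symmx x s t *m symmx x' s' t' = symmx (x + s * x') (s * s') (t * t').
Proof.
apply/matrixP => i j; rewrite !mxE !big_ord_recl big_ord0 !mxE.
by case: i => [[|[|[|//]]] ?]; case: j => [[|[|[|//]]] ?] /=; field.
Qed.

Lemma symmx1 (R : realType) : symmx 0 1 1 = 1%:M :> 'M[R]_3.
Proof.
apply/matrixP => i j; rewrite !mxE.
by case: i => [[|[|[|//]]] ?]; case: j => [[|[|[|//]]] ?] /=; field.
Qed.

Lemma cvg_symmx (R : realType) (x s t : nat -> R) (x' s' t' : R) :
  x @ \oo --> x' -> s @ \oo --> s' -> t @ \oo --> t' ->
  (fun n => symmx (x n) (s n) (t n)) @ \oo --> symmx x' s' t'.
Proof.
move=> cx cs ct.
have cp : (fun n => (s n + t n) / 2) @ \oo --> (s' + t') / 2.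
  by apply: cvgM; [exact: cvgD|exact: cvg_cst].
have cm : (fun n => (s n - t n) / 2) @ \oo --> (s' - t') / 2.
  by apply: cvgM; [exact: cvgB|exact: cvg_cst].
apply: mx_cvg => i j; rewrite !mxE; under eq_fun do rewrite !mxE.
by case: i => [[|[|[|//]]] ?]; case: j => [[|[|[|//]]] ?] //=; exact: cvg_cst.
Qed.

Lemma A_symmx (R : realType) (mu : R) : mu <> 2 -> mu <> 5 ->
  A mu ord0 = symmx ((4 - mu) / ((5 - mu) * (2 - mu)))
                    ((6 - mu) / ((5 - mu) * (2 - mu))) (5 - mu)^-1.
Proof.
move=> /eqP mu2 /eqP mu5.
have m5 : 5 - mu != 0 by rewrite subr_eq0 eq_sym.
have m2 : 2 - mu != 0 by rewrite subr_eq0 eq_sym.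
apply/matrixP => i j; rewrite !mxE.
by case: i => [[|[|[|//]]] ?]; case: j => [[|[|[|//]]] ?] /=; field; rewrite ?m2 ?m5.
Qed.

Lemma A0E (R : realType) (i r c : 'I_3) :
  A (0 : R) i r c = if r == i then (c == i)%:R
                    else if (c == i) || (c == r) then 2 / 5 else 1 / 5.
Proof.
rewrite !mxE -!val_eqE.
by case: i => [[|[|[|//]]] ?]; case: r => [[|[|[|//]]] ?];
  case: c => [[|[|[|//]]] ?] /=; field.
Qed.

Lemma A0_unit (R : realType) (i : 'I_3) : A (0 : R) i \in unitmx.
Proof.
(* The inverse fixes constants and the value at vertex [i], and has the further eigenvalues 5/3 and
   5; their half-sum is 10/3 and their half-difference -5/3. *)
pose B : 'M[R]_3 := \matrix_(r, c) if r == i then (c == i)%:R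
  else if c == i then - (2 / 3) else if c == r then 10 / 3 else - (5 / 3).
suff /mulmx1_unit[] : A 0 i *m B = 1%:M by [].
apply/matrixP => r c; rewrite !mxE !big_ord_recl big_ord0 !A0E !mxE -!val_eqE.
by case: i @B => [[|[|[|//]]] ?] B; case: r => [[|[|[|//]]] ?];
  case: c => [[|[|[|//]]] ?] /=; field.
Qed.

Lemma invmx_A0 (R : realType) : invmx (A (0 : R) ord0) = symmx (- (2 / 3)) (5 / 3) 5.
Proof.
have h : A (0 : R) ord0 *m symmx (- (2 / 3)) (5 / 3) 5 = 1%:M.
  rewrite A_symmx; [|by apply/eqP; rewrite eq_sym pnatr_eq0..].
  by rewrite mulmx_symmx -symmx1; congr symmx; field.
by rewrite -[RHS]mul1mx -(mulVmx (A0_unit R ord0)) -mulmxA h mulmx1.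
Qed.

Lemma symmx_expr (R : realType) (n : nat) :
  symmx (- (2 / 3)) (5 / 3) 5 ^+ n =
  symmx (1 - (5 / 3) ^+ n) ((5 / 3) ^+ n) (5 ^+ n) :> 'M[R]_3.
Proof.
elim: n => [|n IHn]; first by rewrite !expr0 subrr symmx1.
by rewrite exprS IHn -mulmxE mulmx_symmx !exprS; congr symmx; field.
Qed.

(** * Decimation products and associated sequences *)

Lemma decimation_product_refl (R : realType) (lam : nat -> R)
    (w : nat -> 'I_3) (m : nat) : decimation_product lam w m m = 1%:M.
Proof. by rewrite /decimation_product /index_iota subnn big_nil. Qed.

Lemma decimation_product_cat (R : realType) (lam : nat -> R)
    (w : nat -> 'I_3) (m n p : nat) : (m <= n)%N -> (n <= p)%N ->
  decimation_product lam w m p =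
  decimation_product lam w n p *m decimation_product lam w m n.
Proof.
move=> mn np; rewrite /decimation_product mulmxE -big_cat/= -rev_cat.
have e : (p - m = (n - m) + (p - n))%N by rewrite addnC addnBA// subnK.
by rewrite /index_iota e iotaD subnKC.
Qed.

Lemma decimation_productS (R : realType) (lam : nat -> R)
    (w : nat -> 'I_3) (m n : nat) : (m <= n)%N ->
  decimation_product lam w m n.+1 =
  A (lam n.+1) (w n) *m decimation_product lam w m n.
Proof.
move=> mn; rewrite (decimation_product_cat _ _ mn (leqnSn n)).
by rewrite {1}/decimation_product /index_iota subSnn big_seq1.
Qed.

Lemma eq_decimation_product (R : realType) (lam : nat -> R)
    (w v : nat -> 'I_3) (m n : nat) : (forall j, (j < n)%N -> w j = v j) ->
  decimation_product lam w m n = decimation_product lam v m n.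
Proof.
move=> wv; apply: eq_big_seq => j; rewrite mem_rev mem_index_iota => /andP[_ jn].
by rewrite wv.
Qed.

(** By the recurrence a zero at one level forces a zero at the level before, so nonvanishing passes
    to higher levels. *)
Lemma associated_neq0 (R : realType) (m0 k : nat) (lam : nat -> R) (lambda : R) :
  associated m0 lam lambda -> (m0 <= k)%N -> lam k <> 0 ->
  forall n, lam (k + n)%N != 0.
Proof.
move=> [hrec _] mk /eqP lk; elim=> [|n IHn]; first by rewrite addn0.
apply: contraNneq IHn => l0; rewrite addnS in l0.
rewrite -[(k + n)%N]/((k + n).+1.-1) -hrec ?l0 ?mul0r//.
by rewrite ltnS (leq_trans mk)// leq_addr.
Qed.

(** The convergent sequence 3/2 5^m lambda_m is bounded, which gives the decay needed for the
    infinite product in [tau]. *)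
Lemma associated_bound (R : realType) (m0 k : nat) (lam : nat -> R) (lambda : R) :
  associated m0 lam lambda ->
  exists C : R, forall n, `|lam (k + n)%N| <= C * (1 / 5) ^+ n.
Proof.
move=> [_ /cvgP/cvg_seq_bounded[M' [_ /(_ (M' + 1))]]].
rewrite ltrDl ltr01 => /(_ isT); set M := M' + 1 => hM; exists `|M| => n.
have /= := hM (k + n)%N I; rewrite !normrM normfV normrX !normr_nat => h.
have p5 p : 0 < 5 ^+ p :> R by rewrite exprn_gt0.
rewrite expr_div_n expr1n mul1r ler_pdivlMr//.
have : 5 ^+ n * `|lam (k + n)%N| <= 5 ^+ (k + n) * `|lam (k + n)%N|.
  by rewrite ler_wpM2r// ler_weXn2l ?leq_addl// ler1n.
have := ler_norm M; have := normr_ge0 (lam (k + n)%N).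
have : 0 <= 5 ^+ (k + n) * `|lam (k + n)%N| by rewrite mulr_ge0// ltW.
lra.
Qed.

(** The eigenvalue of A_0(lambda_{k+n}) ... A_0(lambda_{k+1}) on (0, 1, 1). *)
Definition decimation_factor (R : realType) (lam : nat -> R) (k n : nat) : R :=
  \prod_(i < n)
    ((6 - lam (k + i).+1) / ((5 - lam (k + i).+1) * (2 - lam (k + i).+1))).

(** * The products beyond level k and their renormalized limit *)

Section SymmetricDecimation.
Variables (R : realType) (lam : nat -> R) (lambda : R) (m0 k : nat).
Hypotheses (hlam : associated m0 lam lambda) (m0k : (m0 <= k)%N).
Hypothesis hforb : forall m, (m0 < m)%N -> lam m <> 2 /\ lam m <> 5.
Hypothesis hlamk : lam k <> 0.

Let lam_rec n : lam (k + n)%N = lam (k + n).+1 * (5 - lam (k + n).+1).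
Proof. by rewrite hlam.1// ltnS (leq_trans m0k)// leq_addr. Qed.

Let lam_neq0 n : lam (k + n)%N != 0.
Proof. exact: (associated_neq0 hlam m0k hlamk). Qed.

Let lam_forb n : lam (k + n).+1 <> 2 /\ lam (k + n).+1 <> 5.
Proof. by apply: hforb; rewrite ltnS (leq_trans m0k)// leq_addr. Qed.

Let lam2 n : 2 - lam (k + n).+1 != 0.
Proof. by rewrite subr_eq0 eq_sym; apply/eqP; case: (lam_forb n). Qed.

Let lam5 n : 5 - lam (k + n).+1 != 0.
Proof. by rewrite subr_eq0 eq_sym; apply/eqP; case: (lam_forb n). Qed.

(* A_0(mu) maps the vector (1, p, p), p = 1 - mu (5 - mu) / 4, to (1, p', p')
   with p' = 1 - mu / 4, and (0, 1, 1), (0, 1, -1) are eigenvectors of it. *)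
Lemma decimation_product_symmx (w : nat -> 'I_3) (n : nat) :
  (forall j, (k <= j)%N -> w j = ord0) ->
  decimation_product lam w k (k + n)%N =
  symmx (1 - lam (k + n)%N / 4 - decimation_factor lam k n * (1 - lam k / 4))
        (decimation_factor lam k n) (lam (k + n)%N / lam k).
Proof.
move=> hw; rewrite /decimation_factor; elim: n => [|n IHn].
  rewrite addn0 decimation_product_refl big_ord0 -symmx1; congr symmx.
    by rewrite mul1r subrr.
  by rewrite divff//; apply/eqP.
have [l2 l5] := lam_forb n.
rewrite addnS decimation_productS ?leq_addr// hw ?leq_addr// IHn A_symmx//.
rewrite mulmx_symmx big_ord_recr/=.
have L := lam_neq0 n.+1; rewrite addnS in L.
have Lk := lam_neq0 0; rewrite addn0 in Lk.
(* Writing lambda_{k+n} through lambda_{k+n+1} turns the three parameters into rational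
   identities. *)
rewrite (lam_rec n); congr symmx; field; rewrite ?lam2 ?lam5 ?L ?Lk//.
Qed.

(** The factors 1/(5 - lambda_j) = lambda_j/lambda_{j-1} telescope. Each numerator 6 - lambda_{j-1}
    over the next denominator 2 - lambda_j is 3 - lambda_j; this leaves over the first denominator
    and the last numerator, and makes the product start at 2. *)
Lemma decimation_factorE (n : nat) :
  (5 / 3) ^+ n.+1 * decimation_factor lam k n.+1 =
  5 ^+ n.+1 * lam (k + n.+1)%N / lam k * ((6 - lam (k + n.+1)%N) / 3) *
  (2 - lam k.+1)^-1 * \prod_(2 <= j < n.+2) (1 - lam (k + j)%N / 3).
Proof.
have Lk := lam_neq0 0; rewrite addn0 in Lk.
elim: n => [|n IHn].
  rewrite big_geq// /decimation_factor big_ord1 /= addn0 addn1.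
  have := lam_rec 0; have := lam2 0; have := lam5 0; have := lam_neq0 1.
  rewrite addn0 addn1 => L l5 l2 ->.
  by field; rewrite L l5 l2.
rewrite exprSr /decimation_factor big_ord_recr/= -/(decimation_factor lam k n.+1).
rewrite mulrACA IHn [in RHS]big_nat_recr//= [in RHS]exprS.
have := lam2 0; have := lam2 n.+1; have := lam5 n.+1.
rewrite (lam_rec n.+1) addn0 -!addnS => l5 l2 l20.
by field; rewrite Lk l20 l5 l2.
Qed.

Lemma cvg_lam : (fun n => lam (k + n)%N) @ \oo --> (0 : R).
Proof.
have [C hC] := associated_bound k hlam.
apply: (@squeeze_cvgr _ _ _ _ (fun n => - geometric C (1 / 5) n)
                              (geometric C (1 / 5))).
- by near=> n; rewrite -ler_norml hC.
- by rewrite -oppr0; apply: cvgN; apply: cvg_geometric; rewrite ger0_norm; lra.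
- by apply: cvg_geometric; rewrite ger0_norm; lra.
Unshelve. all: by end_near. Qed.

(** This makes the [limn] in [tau] a genuine limit. *)
Lemma tau_cvg : cvgn (fun n => \prod_(2 <= j < n) (1 - lam (k + j)%N / 3)).
Proof.
have [C hC] := associated_bound k hlam.
suff /cvg_ex[l hl] : cvgn (fun n => \prod_(0 <= j < n) (1 - lam (k + (j + 2))%N / 3)).
  apply: (cvgP l); rewrite -(@cvg_shiftn 2); apply: cvg_trans hl.
  have -> // : (fun n => \prod_(2 <= j < n + 2) (1 - lam (k + j)%N / 3)) =
          (fun n => \prod_(0 <= j < n) (1 - lam (k + (j + 2))%N / 3)).
  by apply/funext => n; rewrite -[in LHS](add0n 2%N) big_addn addnK.
apply: (@geometric_prod_cvg _ _ C (1 / 5)); [lra|lra|move=> n].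
rewrite normrM normfV normr_nat.
have := hC (n + 2)%N; rewrite exprD.
have := hC 0; rewrite expr0 mulr1 => /(le_trans (normr_ge0 _)) C0.
have : 0 <= C * (1 / 5) ^+ n by rewrite mulr_ge0// exprn_ge0//; lra.
rewrite mulrA; set X := C * _; set Y := `|_|; move=> X0.
by rewrite expr2; lra.
Qed.

Lemma cvg_scaled_lam :
  (fun n => 5 ^+ n * lam (k + n)%N / lam k) @ \oo -->
  2 * lambda / (3 * 5 ^+ k * lam k).
Proof.
have [_] := hlam; rewrite -(@cvg_shiftn k) => h.
have Lk : lam k != 0 by apply/eqP.
have p5 p : 5 ^+ p != 0 :> R by rewrite expf_neq0// pnatr_eq0.
have -> : 2 * lambda / (3 * 5 ^+ k * lam k) =
          2 / (3 * 5 ^+ k * lam k) * lambda by field; rewrite Lk p5.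
have -> : (fun n => 5 ^+ n * lam (k + n)%N / lam k) =
  (fun n => 2 / (3 * 5 ^+ k * lam k) * (3 / 2 * (5 ^+ (n + k) * lam (n + k)%N))).
  by apply/funext => n; rewrite (addnC n k) exprD; field; rewrite Lk p5.
by apply: cvgM => //; exact: cvg_cst.
Qed.

Lemma cvg_decimation_factor :
  (fun n => (5 / 3) ^+ n * decimation_factor lam k n) @ \oo -->
  4 * lambda * tau lam k / (3 * 5 ^+ k * lam k).
Proof.
have Lk : lam k != 0 by apply/eqP.
have p5 p : 5 ^+ p != 0 :> R by rewrite expf_neq0// pnatr_eq0.
rewrite -cvg_shiftS; under eq_fun do rewrite decimation_factorE.
(* The leftover numerator (6 - lambda_{k+n+1})/3 tends to (6 - 0)/3 = 2, which doubles the
   coefficient 2 of [cvg_scaled_lam]. *)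
have -> : 4 * lambda * tau lam k / (3 * 5 ^+ k * lam k) =
  2 * lambda / (3 * 5 ^+ k * lam k) * ((6 - 0) / 3) * (2 - lam k.+1)^-1 *
  limn (fun n => \prod_(2 <= j < n) (1 - lam (k + j)%N / 3)).
  rewrite /tau; set l := limn _; have := lam2 0; rewrite addn0 => l2.
  by field; rewrite Lk p5 l2.
apply: cvgM; last by have := tau_cvg; rewrite -cvg_shiftS -cvg_shiftS.
apply: cvgM; last exact: cvg_cst.
apply: cvgM; first by have := cvg_scaled_lam; rewrite -cvg_shiftS.
apply: cvgM; last exact: cvg_cst.
apply: cvgB; first exact: cvg_cst.
by have := cvg_lam; rewrite -cvg_shiftS.
Qed.

Lemma cvg_tangent_mx (w : nat -> 'I_3) :
  (forall j, (k <= j)%N -> w j = ord0) ->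
  (fun n => invmx (A 0 ord0) ^+ n *m decimation_product lam w k (k + n)%N)
    @ \oo --> M0 lambda lam k.
Proof.
move=> hw.
have Lk : lam k != 0 by apply/eqP.
have p5 p : 5 ^+ p != 0 :> R by rewrite expf_neq0// pnatr_eq0.
(* The eigenvalues are the sum and the difference of the last two entries of the second row. The
   factor 0 is the limit of 3^{-n}, kept to match the sequence below. *)
have -> : M0 lambda lam k =
  symmx (1 - 2 * lambda / (3 * 5 ^+ k * lam k) * (lam k / 4) * 0 -
         4 * lambda * tau lam k / (3 * 5 ^+ k * lam k) * (1 - lam k / 4))
    (4 * lambda * tau lam k / (3 * 5 ^+ k * lam k))
    (2 * lambda / (3 * 5 ^+ k * lam k)).
  rewrite /M0 /symmx; congr mx3.
  by congr [:: _; [:: _; _; _]; [:: _; _; _]]; field; rewrite Lk p5.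
(* The term (5/3)^n lambda_{k+n}/4 is split into the convergent 5^n lambda_{k+n}/lambda_k and the
   vanishing 3^{-n}. *)
have -> : (fun n => invmx (A 0 ord0) ^+ n *m decimation_product lam w k (k + n)%N) =
  (fun n => symmx (1 - 5 ^+ n * lam (k + n)%N / lam k * (lam k / 4) * (3^-1) ^+ n -
         (5 / 3) ^+ n * decimation_factor lam k n * (1 - lam k / 4))
    ((5 / 3) ^+ n * decimation_factor lam k n)
    (5 ^+ n * lam (k + n)%N / lam k)).
  apply/funext => n; rewrite invmx_A0 symmx_expr decimation_product_symmx//.
  rewrite mulmx_symmx mulrA; congr symmx; rewrite expr_div_n exprVn.
  by field; rewrite Lk expf_neq0// pnatr_eq0.
apply: cvg_symmx; last exact: cvg_scaled_lam.
  apply: cvgB; last by apply: cvgM; [exact: cvg_decimation_factor|exact: cvg_cst].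
  apply: cvgB; first exact: cvg_cst.
  apply: cvgM; first by apply: cvgM; [exact: cvg_scaled_lam|exact: cvg_cst].
  rewrite [X in X @ _](_ : _ = geometric 1 3^-1); last first.
    by apply/funext => n /=; rewrite mul1r.
  by apply: cvg_geometric; rewrite ger0_norm; lra.
exact: cvg_decimation_factor.
Qed.
End SymmetricDecimation.

(** * One harmonic subdivision: oscillation and flux *)

Lemma ord3_ind (P : 'I_3 -> Prop) :
  P (@Ordinal 3 0 isT) -> P (@Ordinal 3 1 isT) -> P (@Ordinal 3 2 isT) ->
  forall i, P i.
Proof.
by move=> P0 P1 P2 [[|[|[|//]]] h]; rewrite (bool_irrelevance h isT).
Qed.

Definition osc_le (R : realType) (B : 'cV[R]_3) (c : R) : Prop :=
  forall i j, `|B i ord0 - B j ord0| <= c.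

Lemma osc_le_exists (R : realType) (B : 'cV[R]_3) : exists c, osc_le B c.
Proof.
exists (\sum_i \sum_j `|B i ord0 - B j ord0|) => i j.
rewrite (bigD1 i)//= (bigD1 j)//= -addrA lerDl addr_ge0// ?sumr_ge0//.
by move=> l _; exact: sumr_ge0.
Qed.

Lemma big_ord3 (R : realType) (f : 'I_3 -> R) :
  \sum_i f i = f (@Ordinal 3 0 isT) + f (@Ordinal 3 1 isT) + f (@Ordinal 3 2 isT).
Proof.
rewrite !big_ord_recl big_ord0 addr0 addrA.
by congr (f _ + f _ + f _); apply: val_inj.
Qed.

(** For [r] other than [i], the value at the third vertex is the total minus the two others, so that
    vertex need not be named. *)
Lemma A0_colE (R : realType) (B : 'cV[R]_3) (i r : 'I_3) :
  (A 0 i *m B) r ord0 = if r == i then B i ord0 else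
    (2 / 5) * (B i ord0 + B r ord0) + (1 / 5) *
    (B (@Ordinal 3 0 isT) ord0 + B (@Ordinal 3 1 isT) ord0 +
     B (@Ordinal 3 2 isT) ord0 - B i ord0 - B r ord0).
Proof.
rewrite mxE big_ord3 !A0E.
by move: i r; elim/ord3_ind; elim/ord3_ind => /=; field.
Qed.

(** This is the scaling by 3/5 of the unrenormalized normal derivative at a corner. *)
Lemma A0_flux (R : realType) (B : 'cV[R]_3) (j : 'I_3) :
  \sum_i ((A 0 j *m B) i ord0 - (A 0 j *m B) j ord0) =
  3 / 5 * \sum_i (B i ord0 - B j ord0).
Proof.
by rewrite !big_ord3 !A0_colE; move: j; elim/ord3_ind => /=; field.
Qed.

(* The normal derivatives from the two sides of a junction point cancel. *)
Lemma A0_flux_balance (R : realType) (B : 'cV[R]_3) (i j : 'I_3) : i <> j ->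
  \sum_l ((A 0 i *m B) l ord0 - (A 0 i *m B) j ord0) +
  \sum_l ((A 0 j *m B) l ord0 - (A 0 j *m B) i ord0) = 0.
Proof.
rewrite !big_ord3 !A0_colE.
by move: i j; elim/ord3_ind; elim/ord3_ind => //= _; field.
Qed.

(** The rows of A_i are probability vectors, any two of which share mass at least 2/5. *)
Lemma osc_A0 (R : realType) (B : 'cV[R]_3) (c : R) (i : 'I_3) :
  osc_le B c -> osc_le (A 0 i *m B) (3 / 5 * c).
Proof.
move=> hB r s; rewrite !A0_colE.
have h j l : B j ord0 - B l ord0 <= c := le_trans (ler_norm _) (hB j l).
have h01 := h (@Ordinal 3 0 isT) (@Ordinal 3 1 isT).
have h10 := h (@Ordinal 3 1 isT) (@Ordinal 3 0 isT).
have h02 := h (@Ordinal 3 0 isT) (@Ordinal 3 2 isT).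
have h20 := h (@Ordinal 3 2 isT) (@Ordinal 3 0 isT).
have h12 := h (@Ordinal 3 1 isT) (@Ordinal 3 2 isT).
have h21 := h (@Ordinal 3 2 isT) (@Ordinal 3 1 isT).
rewrite ler_norml.
by move: i r s; elim/ord3_ind; elim/ord3_ind; elim/ord3_ind => /=;
  apply/andP; split; lra.
Qed.

Lemma osc_A0_step (R : realType) (B : 'cV[R]_3) (c : R) (i r : 'I_3) :
  osc_le B c -> `|(A 0 i *m B) r ord0 - B r ord0| <= c.
Proof.
move=> hB; rewrite !A0_colE.
have h j l : B j ord0 - B l ord0 <= c := le_trans (ler_norm _) (hB j l).
have h00 := h (@Ordinal 3 0 isT) (@Ordinal 3 0 isT).
have h01 := h (@Ordinal 3 0 isT) (@Ordinal 3 1 isT).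
have h10 := h (@Ordinal 3 1 isT) (@Ordinal 3 0 isT).
have h02 := h (@Ordinal 3 0 isT) (@Ordinal 3 2 isT).
have h20 := h (@Ordinal 3 2 isT) (@Ordinal 3 0 isT).
have h12 := h (@Ordinal 3 1 isT) (@Ordinal 3 2 isT).
have h21 := h (@Ordinal 3 2 isT) (@Ordinal 3 1 isT).
rewrite ler_norml.
by move: i r; elim/ord3_ind; elim/ord3_ind => /=;
  apply/andP; split; lra.
Qed.

(** * Barycentric coordinates and the overlap of cells *)

Definition cross (R : realType) (x y : 'rV[R]_2) : R :=
  x ord0 ord0 * y ord0 (lift ord0 ord0) - x ord0 (lift ord0 ord0) * y ord0 ord0.

(* The i-th coordinate is the ratio of the signed areas of the triangle with
   [q i] replaced by [x] and of the whole triangle. *)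
Definition bary (R : realType) (q : 'I_3 -> 'rV[R]_2) (i : 'I_3)
    (x : 'rV[R]_2) : R :=
  let q0 := q (@Ordinal 3 0 isT) in
  let q1 := q (@Ordinal 3 1 isT) in
  let q2 := q (@Ordinal 3 2 isT) in
  nth 0 [:: cross (q1 - x) (q2 - x); cross (q2 - x) (q0 - x);
            cross (q0 - x) (q1 - x)] i / cross (q1 - q0) (q2 - q0).

(** By Lagrange's identity, when all squared sides equal d, four times the square of the cross
    product is 4 d^2 - d^2 = 3 d^2. *)
Lemma equilateral_cross (R : realType) (q : 'I_3 -> 'rV[R]_2) :
  equilateral q ->
  cross (q (@Ordinal 3 1 isT) - q (@Ordinal 3 0 isT))
        (q (@Ordinal 3 2 isT) - q (@Ordinal 3 0 isT)) != 0.
Proof.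
move=> [d d0 hd].
have gram (a b c e : R) : a ^+ 2 + b ^+ 2 = d -> c ^+ 2 + e ^+ 2 = d ->
    (a - c) ^+ 2 + (b - e) ^+ 2 = d -> a * e - b * c != 0.
  move=> h1 h2 h3; apply: contraTneq d0 => c0.
  have : 4 * (a * e - b * c) ^+ 2 = 4 * ((a ^+ 2 + b ^+ 2) * (c ^+ 2 + e ^+ 2)) -
      (a ^+ 2 + b ^+ 2 + (c ^+ 2 + e ^+ 2) - ((a - c) ^+ 2 + (b - e) ^+ 2)) ^+ 2.
    by ring.
  rewrite c0 h1 h2 h3; apply: contra_eqN => d0'.
  have -> : 4 * (d * d) - (d + d - d) ^+ 2 = 3 * d ^+ 2 by ring.
  by rewrite expr0n mulr0 eq_sym gt_eqF// mulr_gt0// exprn_gt0.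
have := hd (@Ordinal 3 1 isT) (@Ordinal 3 0 isT) isT.
have := hd (@Ordinal 3 2 isT) (@Ordinal 3 0 isT) isT.
have := hd (@Ordinal 3 1 isT) (@Ordinal 3 2 isT) isT.
rewrite /cross !mxE !big_ord_recl !big_ord0 !addr0 => h12 h20 h10.
by apply: gram h10 h20 _; rewrite -h12; ring.
Qed.

Section Gasket.
Variables (R : realType) (q : 'I_3 -> 'rV[R]_2) (hq : equilateral q).
Variables (SG : set 'rV[R]_2) (hSG : is_SG q SG).

Lemma bary_F i j x : bary q i (F q j x) = (bary q i x + (i == j)%:R) / 2.
Proof.
have := equilateral_cross hq; rewrite /bary /cross /F !mxE.
by move: i j; elim/ord3_ind; elim/ord3_ind => /= h; field.
Qed.

Lemma bary_q i j : bary q i (q j) = (i == j)%:R.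
Proof.
have := equilateral_cross hq; rewrite /bary /cross !mxE.
by move: i j; elim/ord3_ind; elim/ord3_ind => /= h; field.
Qed.

Lemma bary_sum x : bary q (@Ordinal 3 0 isT) x + bary q (@Ordinal 3 1 isT) x
  + bary q (@Ordinal 3 2 isT) x = 1.
Proof.
have := equilateral_cross hq; rewrite /bary /cross !mxE /= => h.
by field.
Qed.

Lemma bary_combination x : x = bary q (@Ordinal 3 0 isT) x *: q (@Ordinal 3 0 isT)
  + bary q (@Ordinal 3 1 isT) x *: q (@Ordinal 3 1 isT)
  + bary q (@Ordinal 3 2 isT) x *: q (@Ordinal 3 2 isT).
Proof.
have := equilateral_cross hq; rewrite /bary /cross !mxE /= => h.
apply/rowP => c; rewrite !mxE.
by case: (unliftP ord0 c) => [j ->|->]; rewrite ?[j]ord1; field.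
Qed.

Lemma bary_inj x y : (forall i, bary q i x = bary q i y) -> x = y.
Proof. by move=> h; rewrite (bary_combination x) (bary_combination y) !h. Qed.

Lemma bary_continuous i : continuous (bary q i).
Proof.
have cc (f g : 'rV[R]_2 -> 'rV[R]_2) : continuous f -> continuous g ->
    continuous (fun x => cross (f x) (g x)).
  move=> cf cg x; have co (h : 'rV[R]_2 -> 'rV[R]_2) c : continuous h ->
      (fun y => h y ord0 c) y @[y --> x] --> h x ord0 c.
    move=> ch; apply: (@cvg_comp _ _ _ h (fun M : 'rV[R]_2 => M ord0 c) _ _ _ (ch x)).
    exact: coord_continuous.
  exact: (cvgB (cvgM (co f _ cf) (co g _ cg)) (cvgM (co f _ cf) (co g _ cg))).
have cs (a : 'rV[R]_2) : continuous (fun x : 'rV[R]_2 => a - x).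
  move=> x; apply: (@cvgB _ _ _ (nbhs x) _ (fun=> a) id).
    exact: (@cvg_cst _ a _ (nbhs x) _).
  exact: cvg_id.
move=> x; rewrite /bary; set c := _^-1.
apply: (@cvgM _ _ (nbhs x) _ (fun y => nth 0 _ i) (fun=> c)).
  by move: i; elim/ord3_ind => /=; exact: (cc _ _ (cs _) (cs _) x).
exact: (@cvg_cst _ c _ (nbhs x) _).
Qed.

Lemma F_inj i x y : F q i x = F q i y -> x = y.
Proof.
move=> h; apply: bary_inj => j.
have := congr1 (bary q j) h; rewrite !bary_F; lra.
Qed.

Lemma F_continuous i : continuous (F q i).
Proof.
move=> x; apply: (@cvgZr _ _ _ (nbhs x) _ 2^-1 (fun x => x + q i)).
apply: (@cvgD _ _ _ (nbhs x) _ id (fun=> q i)); first exact: cvg_id.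
exact: (@cvg_cst _ (q i) _ (nbhs x) _).
Qed.

Lemma F_fixed i : F q i (q i) = q i.
Proof.
by apply: bary_inj => j; rewrite bary_F bary_q; case: eqP => _ /=; field.
Qed.

Lemma F_junction i j : F q i (q j) = F q j (q i).
Proof. by rewrite /F addrC. Qed.

Lemma q_inj i j : q i = q j -> i = j.
Proof.
move=> h; have := congr1 (bary q i) h; rewrite !bary_q eqxx.
by case: eqP => //= _ /eqP; rewrite oner_eq0.
Qed.

Lemma SG_F i x : SG x -> SG (F q i x).
Proof. by move=> Sx; case: hSG => _ _ ->; exists i => //; exists x. Qed.

Lemma SG_cover x : SG x -> exists i y, SG y /\ x = F q i y.
Proof.
by case: hSG => _ _ {1}-> [i _ [y Sy <-]]; exists i, y.
Qed.

(** The minimum over the compact gasket is attained at some F_j(y), where the coordinate is at least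
    half of its value at [y]; hence the minimum is at least half of itself. *)
Lemma SG_bary_ge0 i x : SG x -> 0 <= bary q i x.
Proof.
have [S0 cS _] := hSG.
have cb : {within SG, continuous (bary q i)}.
  by apply: continuous_subspaceT; exact: bary_continuous.
have [c /set_mem Sc hc] := compact_EVT_min S0 cS cb.
move=> Sx; apply: le_trans (hc x (mem_set Sx)).
have [j [y [Sy e]]] := SG_cover Sc.
have := hc y (mem_set Sy); rewrite e bary_F.
by have : 0 <= (i == j)%:R :> R by []; lra.
Qed.

Lemma SG_corner i x : SG x -> 1 <= bary q i x -> x = q i.
Proof.
move=> Sx bx; apply: bary_inj => j; rewrite bary_q; have := bary_sum x.
have h l := SG_bary_ge0 l Sx.
have := h (@Ordinal 3 0 isT); have := h (@Ordinal 3 1 isT).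
have := h (@Ordinal 3 2 isT).
by move: i j bx; elim/ord3_ind; elim/ord3_ind => /=; lra.
Qed.

(** If M is the maximum of the i-th coordinate, applying F_i to a maximizer gives (M + 1)/2 <= M, so
    M >= 1 and the maximizer is the corner. *)
Lemma SG_q i : SG (q i).
Proof.
have [S0 cS _] := hSG.
have cb : {within SG, continuous (bary q i)}.
  by apply: continuous_subspaceT; exact: bary_continuous.
have [c /set_mem Sc hc] := compact_EVT_max S0 cS cb.
rewrite -(SG_corner (i := i) Sc)//.
by have := hc _ (mem_set (SG_F i Sc)); rewrite bary_F eqxx /=; lra.
Qed.

(** Comparing i-th coordinates, that of [y] is 1 plus that of [x], hence at least 1, and [y] is a
    corner; likewise for [x] with j. *)
Lemma overlap i j x y : SG x -> SG y -> i <> j -> F q i x = F q j y ->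
  x = q j /\ y = q i.
Proof.
move=> Sx Sy /eqP ij e.
have hi := congr1 (bary q i) e; have hj := congr1 (bary q j) e.
move: hi hj; rewrite !bary_F !eqxx [j == i]eq_sym (negbTE ij) /= => hi hj.
have := SG_bary_ge0 i Sx; have := SG_bary_ge0 j Sy.
by split; apply: SG_corner => //; lra.
Qed.

Lemma F_eq_q i j y : SG y -> F q i y = q j -> i = j /\ y = q j.
Proof.
move=> Sy e; have [//|ij] := pselect (i = j); last first.
  have [yj jj] := overlap Sy (SG_q j) ij (etrans e (esym (F_fixed j))).
  by case: ij; exact: q_inj.
move=> ij; split=> //; move: e; rewrite ij -{1}(F_fixed j).
exact: F_inj.
Qed.

(** * Harmonic functions built along addresses *)

(* An address digit of [x] and the point of the gasket it is read off from;
   [(0, 0)] off the gasket. *)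
Definition split_cell (x : 'rV[R]_2) : 'I_3 * 'rV[R]_2 :=
  xget (ord0, 0) [set p | SG p.2 /\ x = F q p.1 p.2].

Lemma split_cellP x : SG x ->
  SG (split_cell x).2 /\ x = F q (split_cell x).1 (split_cell x).2.
Proof.
move=> /SG_cover[i [y h]]; rewrite /split_cell.
by case: xgetP => [p -> //|/(_ (i, y))]; apply: contra_notP.
Qed.

Fixpoint cell_values (n : nat) (B : 'cV[R]_3) (x : 'rV[R]_2) : 'cV[R]_3 :=
  if n is n'.+1 then
    cell_values n' (A 0 (split_cell x).1 *m B) (split_cell x).2
  else B.

(** Any entry would give the same limit, since the oscillation of the vectors tends to 0. *)
Definition harmonic_ext (B : 'cV[R]_3) (x : 'rV[R]_2) : R :=
  limn (fun n => cell_values n B x ord0 ord0).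

(** The recursion puts each new matrix next to [B]; the contraction estimates need the last one on
    the left. *)
Lemma cell_valuesS n B x :
  exists i, cell_values n.+1 B x = A 0 i *m cell_values n B x.
Proof.
elim: n B x => [|n IHn] B x; first by exists (split_cell x).1.
have [i e] := IHn (A 0 (split_cell x).1 *m B) (split_cell x).2.
by exists i; rewrite [LHS]/= -[cell_values n _ _]/(cell_values n.+1 _ _) -e.
Qed.

Lemma cell_values_osc n B c x : osc_le B c ->
  osc_le (cell_values n B x) ((3 / 5) ^+ n * c).
Proof.
move=> hB; elim: n => [|n IHn]; first by rewrite expr0 mul1r.
by have [i ->] := cell_valuesS n B x; rewrite exprS -mulrA; exact: osc_A0.
Qed.

Lemma cell_values_incr n B c x : osc_le B c ->
  `|cell_values n.+1 B x ord0 ord0 - cell_values n B x ord0 ord0| <=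
  c * (3 / 5) ^+ n.
Proof.
move=> /(cell_values_osc n x) h; have [i ->] := cell_valuesS n B x.
by rewrite mulrC; exact: osc_A0_step.
Qed.

Lemma cell_values_cvg B x : cvgn (fun n => cell_values n B x ord0 ord0).
Proof.
have [c hc] := osc_le_exists B.
by apply: (@geometric_increments_cvg _ _ c (3 / 5)); [lra|lra|move=> n];
  exact: cell_values_incr.
Qed.

Lemma harmonic_ext_split B x :
  harmonic_ext B x = harmonic_ext (A 0 (split_cell x).1 *m B) (split_cell x).2.
Proof.
have := @cell_values_cvg B x; rewrite -cvg_shiftS => h.
by apply/esym; exact: cvg_lim h.
Qed.

(** The only address of q_i is iii..., along which the i-th entry is constant; entry 0 differs from
    it by at most the oscillation. *)
Lemma harmonic_ext_q B i : harmonic_ext B (q i) = B i ord0.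
Proof.
have [Sy /esym e] := split_cellP (SG_q i).
have [ei ey] := F_eq_q Sy e.
have fixi n : cell_values n B (q i) i ord0 = B i ord0.
  elim: n B => [//|n IHn] B /=; rewrite ey ei IHn.
  by rewrite A0_colE eqxx.
have [c hc] := osc_le_exists B.
apply: cvg_lim => //.
have c0 : ((fun n => B i ord0 - geometric c (3 / 5) n) @ \oo --> B i ord0) /\
          ((fun n => B i ord0 + geometric c (3 / 5) n) @ \oo --> B i ord0).
  have g0 : geometric c (3 / 5) @ \oo --> 0.
    by apply: cvg_geometric; rewrite ger0_norm; lra.
  split; [rewrite -[X in _ --> X]subr0; apply: cvgB|
          rewrite -[X in _ --> X]addr0; apply: cvgD] => //; exact: cvg_cst.
apply: (squeeze_cvgr _ c0.1 c0.2); near=> n.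
have := cell_values_osc n (q i) hc ord0 i; rewrite fixi /= ler_distl.
by rewrite [_ * c]mulrC.
Unshelve. all: by end_near. Qed.

(** Independence of the address: if the chosen digit j differs from i, the point is the junction of
    the two cells, and entry j of A_i B equals entry i of A_j B. *)
Lemma harmonic_ext_F B i x : SG x ->
  harmonic_ext B (F q i x) = harmonic_ext (A 0 i *m B) x.
Proof.
move=> Sx; rewrite harmonic_ext_split.
have [] := split_cellP (SG_F i Sx).
move: (split_cell _) => [j y] /= Sy e.
have [ij|ij] := pselect (i = j).
  by move: e; rewrite ij => /F_inj->.
have [-> ->] := overlap Sx Sy ij e.
rewrite !harmonic_ext_q !A0_colE; move/eqP: ij.
by rewrite [j == i]eq_sym => /negbTE ->; ring.
Qed.

Lemma harmonic_ext_osc B c x y : osc_le B c ->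
  `|harmonic_ext B x - harmonic_ext B y| <= 5 * c.
Proof.
move=> hc.
have b z : `|harmonic_ext B z - B ord0 ord0| <= c / (1 - 3 / 5).
  have h n := @geometric_increments_bound _
    (fun n => cell_values n B z ord0 ord0) c (3 / 5) n.
  have {}h n : `|cell_values n B z ord0 ord0 - B ord0 ord0| <= c / (1 - 3 / 5).
    by apply: h => [||m]; [lra|lra|exact: cell_values_incr].
  rewrite ler_distl; apply/andP; split.
    apply: limr_ge; first exact: (@cell_values_cvg B z).
    by near=> n; have := h n; rewrite ler_distl => /andP[].
  apply: limr_le; first exact: (@cell_values_cvg B z).
  by near=> n; have := h n; rewrite ler_distl => /andP[].
(* Both values lie within 5/2 c of the same entry of [B], whence 5 c. *)
have e : c / (1 - 3 / 5) = 5 / 2 * c by field.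
have := b x; have := b y; rewrite e !ler_distl => /andP[h1 h2] /andP[h3 h4].
by apply/andP; split; lra.
Unshelve. all: by end_near. Qed.

Lemma F_SG_closed i : closed (F q i @` SG).
Proof.
apply: compact_closed; first exact: norm_hausdorff.
apply: continuous_compact; last by case: hSG.
by apply: continuous_subspaceT; exact: F_continuous.
Qed.

(* Near a junction point all the cells containing it are treated at once, so
   that no pasting of continuous functions is needed. *)
Lemma harmonic_ext_near n B c x : osc_le B c -> SG x ->
  \forall y \near x, SG y ->
    `|harmonic_ext B x - harmonic_ext B y| <= (3 / 5) ^+ n * (5 * c).
Proof.
elim: n B c x => [|n IHn] B c x hc Sx.
  by near=> y => _; rewrite expr0 mul1r; exact: harmonic_ext_osc.
suff : \forall y \near x, forall i z, SG z -> y = F q i z ->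
    `|harmonic_ext B x - harmonic_ext B y| <= (3 / 5) ^+ n.+1 * (5 * c).
  apply: filterS => y hy Sy; have [i [z [Sz e]]] := SG_cover Sy.
  exact: hy Sz e.
apply: (@filter_forall _ _ (fun i => [set y | forall z, SG z -> y = F q i z ->
    `|harmonic_ext B x - harmonic_ext B y| <= (3 / 5) ^+ n.+1 * (5 * c)]) (nbhs x)).
(* A cell not containing [x] is closed, so it misses a neighbourhood of [x] and the claim is vacuous
   there. *)
move=> i; have [[x' Sx' e]|nx] := pselect ((F q i @` SG) x); last first.
  have : nbhs x (~` (F q i @` SG)).
    by apply: open_nbhs_nbhs; split => //; apply: closed_openC; exact: F_SG_closed.
  by apply: filterS => y ny z Sz yz; case: ny; exists z.
(* The inverse 2 y - q_i of F_i. *)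
pose G (y : 'rV[R]_2) := y + (y - q i).
have GF z : G (F q i z) = z.
  by rewrite /G /F; apply/rowP => l; rewrite !mxE; field.
have Gx : G y @[y --> x] --> x'.
  rewrite -(GF x') e; apply: (@cvgD _ _ _ (nbhs x) _ id (fun y => y - q i)).
    exact: cvg_id.
  apply: (@cvgB _ _ _ (nbhs x) _ id (fun=> q i)); first exact: cvg_id.
  exact: (@cvg_cst _ (q i) _ (nbhs x) _).
have : \forall y \near x, SG (G y) -> `|harmonic_ext (A 0 i *m B) x' -
    harmonic_ext (A 0 i *m B) (G y)| <= (3 / 5) ^+ n * (5 * (3 / 5 * c)).
  exact: (Gx _ (IHn _ _ _ (osc_A0 i hc) Sx')).
apply: filterS => y /= hy z Sz yz; move: hy; rewrite yz GF => /(_ Sz).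
by rewrite -e !harmonic_ext_F// exprSr mulrCA => h; apply: le_trans h _; lra.
Unshelve. all: by end_near. Qed.

Lemma harmonic_ext_continuous B : {within SG, continuous (harmonic_ext B)}.
Proof.
apply/subspace_continuousP => x Sx; apply/cvgrPdist_le => e e0.
have [c hc] := osc_le_exists B.
have g0 : geometric (5 * c) (3 / 5) @ \oo --> (0 : R).
  by apply: cvg_geometric; rewrite ger0_norm; lra.
move/cvgr0Pnorm_le: g0 => /(_ _ e0)[n _ /(_ n (leqnn n)) /= hn].
have := harmonic_ext_near n hc Sx; apply: filterS => y hy Sy.
apply: le_trans (hy Sy) _; rewrite mulrC.
exact: le_trans (ler_norm _) hn.
Qed.

(** * Vertices, adjacency and graph Laplacians of the extension *)

Lemma V0E x : V q 0 x <-> exists i, x = q i.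
Proof.
split=> [[w [/size0nil -> [i ->]]]|[i ->]]; first by exists i.
by exists [::]; split=> //; exists i.
Qed.

Lemma VS m x : V q m.+1 x <-> exists i y, V q m y /\ x = F q i y.
Proof.
split=> [[w [sw [j ->]]]|[i [_ [[w [sw [j ->]]] ->]]]].
  case: w sw => [//|i w] [sw].
  by exists i, (Fw q w (q j)); split => //; exists w; split=> //; exists j.
by exists (i :: w); split; [rewrite /= sw|exists j].
Qed.

Lemma V_SG m x : V q m x -> SG x.
Proof.
elim: m x => [|m IHm] x; first by move=> /V0E[i ->]; exact: SG_q.
by move=> /VS[i [y [/IHm Sy ->]]]; exact: SG_F.
Qed.

Lemma V_q m i : V q m (q i).
Proof.
elim: m => [|m IHm]; first by apply/V0E; exists i.
by apply/VS; exists i, (q i); split=> //; rewrite F_fixed.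
Qed.

(** If the vertex is obtained through another cell, [overlap] makes [y] a corner, and corners belong
    to every V_m. *)
Lemma V_F m i y : SG y -> V q m.+1 (F q i y) -> V q m y.
Proof.
move=> Sy /VS[j [z [Vz e]]]; have [ij|ij] := pselect (i = j).
  by move: e; rewrite ij => /F_inj->.
by have [-> _] := overlap Sy (V_SG Vz) ij e; exact: V_q.
Qed.

Lemma V_finite m : finite_set (V q m).
Proof.
elim: m => [|m IHm].
  apply: (@sub_finite_set _ _ (q @` setT)).
    by move=> x /V0E[i ->]; exists i.
  by apply: finite_image; exact: finite_finset.
apply: (@sub_finite_set _ _ (\bigcup_(i in [set: 'I_3]) (F q i @` V q m))).
  by move=> x /VS[i [y [Vy ->]]]; exists i => //; exists y.
by apply: bigcup_finite; [exact: finite_finset|move=> i _; exact: finite_image].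
Qed.

Lemma Fw_SG w x : SG x -> SG (Fw q w x).
Proof. by move=> Sx; elim: w => [//|i w IHw] /=; exact: SG_F. Qed.

Lemma adjacent0 x y :
  Defs.adjacent q SG 0 x y <-> [/\ x <> y, V q 0 x & V q 0 y].
Proof.
split=> [[]//|[xy Vx Vy]]; split=> //; exists [::]; split=> //.
  by exists x => //; exact: V_SG Vx.
by exists y => //; exact: V_SG Vy.
Qed.

Lemma adjacentS m x y : Defs.adjacent q SG m.+1 x y <->
  exists i x' y', [/\ Defs.adjacent q SG m x' y', x = F q i x' & y = F q i y'].
Proof.
split=> [[xy Vx Vy [w [sw [x' Sx ex] [y' Sy ey]]]]|].
  case: w sw ex ey => [//|i w] [sw] ex ey.
  exists i, (Fw q w x'), (Fw q w y'); split=> //; split.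
  - by move=> e; apply: xy; rewrite -ex -ey /= e.
  - by apply: (@V_F _ i); [exact: Fw_SG|move: Vx; rewrite -ex].
  - by apply: (@V_F _ i); [exact: Fw_SG|move: Vy; rewrite -ey].
  - by exists w.
move=> [i [x' [y' [[xy Vx Vy [w [sw [x0 Sx ex] [y0 Sy ey]]]] -> ->]]]]; split.
- by move/F_inj.
- by apply/VS; exists i, x'.
- by apply/VS; exists i, y'.
- exists (i :: w); split; first by rewrite /= sw.
    by exists x0 => //=; rewrite -/(Fw q w x0) ex.
  by exists y0 => //=; rewrite -/(Fw q w y0) ey.
Qed.

Lemma adjacent_finite m x : finite_set [set y | Defs.adjacent q SG m x y].
Proof. by apply: sub_finite_set (V_finite m) => y []. Qed.

Lemma graph_laplacian_eq m u v x : SG x -> (forall y, SG y -> u y = v y) ->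
  graph_laplacian q SG m u x = graph_laplacian q SG m v x.
Proof.
move=> Sx uv; apply: eq_fsbigr => y /set_mem [_ _ Vy _].
by rewrite !uv//; exact: V_SG Vy.
Qed.

Lemma fsbig_adjacent_F m (u : 'rV[R]_2 -> R) i x c :
  \sum_(y \in F q i @` [set y | Defs.adjacent q SG m x y]) (u y - c) =
  \sum_(y \in [set y | Defs.adjacent q SG m x y]) (u (F q i y) - c).
Proof. by rewrite fsbig_image// => y z _ _; exact: F_inj. Qed.

(** The condition on [x] keeps F_i(x) off the junction points F_i(q_j), so all its neighbours lie in
    cell i. *)
Lemma graph_laplacian_F m u i x : SG x -> (forall j, x = q j -> j = i) ->
  graph_laplacian q SG m.+1 u (F q i x) =
  graph_laplacian q SG m (u \o F q i) x.
Proof.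
move=> Sx xi; rewrite /graph_laplacian -fsbig_adjacent_F.
apply: eq_fsbigl; apply/seteqP; split=> [_ /adjacentS[j [x' [y' [h e ->]]]]|].
  have [ij|ij] := pselect (i = j).
    by rewrite -ij; exists y' => //; move: e; rewrite -ij => /F_inj->.
  have [_ Vx _ _] := h.
  by have [/xi] := overlap Sx (V_SG Vx) ij e => /esym.
by move=> _ [y h <-]; apply/adjacentS; exists i, x, y.
Qed.

(** The neighbours come from two cells that share only the junction point, which is not its own
    neighbour; the sum therefore splits. *)
Lemma graph_laplacian_junction m u i j : i <> j ->
  graph_laplacian q SG m.+1 u (F q i (q j)) =
  graph_laplacian q SG m (u \o F q i) (q j) +
  graph_laplacian q SG m (u \o F q j) (q i).
Proof.
move=> ij; rewrite {2 3}/graph_laplacian /= -!fsbig_adjacent_F.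
rewrite -(F_junction i j) -fsbigU0.
- apply: eq_fsbigl; apply/seteqP; split.
    move=> _ /adjacentS[l [x' [y' [h e ->]]]].
    have [_ Vx _ _] := h.
    have [il|il] := pselect (i = l).
      by left; rewrite -il; exists y' => //; move: e; rewrite -il => /F_inj->.
    have [/q_inj jl xi] := overlap (SG_q j) (V_SG Vx) il e.
    by right; rewrite jl; exists y' => //; rewrite -xi.
  move=> _ [[y h <-]|[y h <-]]; apply/adjacentS; first by exists i, (q j), y.
  by exists j, (q i), y; split=> //; exact: F_junction.
- by apply: finite_image; exact: adjacent_finite.
- by apply: finite_image; exact: adjacent_finite.
- move=> _ [[y [yj _ Vy _] <-] [z [_ _ Vz _] e]].
  by have [/esym] := overlap (V_SG Vy) (V_SG Vz) ij (esym e).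
Qed.

Lemma graph_laplacian0 u j :
  graph_laplacian q SG 0 u (q j) = \sum_i (u (q i) - u (q j)).
Proof.
rewrite (bigD1 j)//= subrr add0r /graph_laplacian.
have -> : [set y | Defs.adjacent q SG 0 (q j) y] = q @` [set` [pred i | i != j]].
  apply/seteqP; split.
    move=> y /adjacent0[yj _ /V0E[i yi]]; exists i => //=.
    by rewrite inE; apply/eqP => ij; apply: yj; rewrite yi ij.
  move=> _ [i /= + <-]; rewrite inE => /eqP ij; apply/adjacent0; split.
  - by move=> /q_inj ji; exact: ij.
  - exact: (V_q 0 j).
  - exact: (V_q 0 i).
rewrite fsbig_image; last by move=> i l _ _; exact: q_inj.
rewrite -[RHS]big_filter [RHS]fsbig_seq ?filter_uniq ?index_enum_uniq//.
apply: eq_fsbigl; apply/seteqP; split=> i /=; rewrite mem_filter inE.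
  by move=> ->; rewrite mem_index_enum.
by case/andP.
Qed.

(** As F_j fixes q_j, each level restricts to cell j and brings one factor 3/5 from [A0_flux]. *)
Lemma graph_laplacian_corner m B j :
  graph_laplacian q SG m (harmonic_ext B) (q j) =
  (3 / 5) ^+ m * \sum_i (B i ord0 - B j ord0).
Proof.
elim: m B => [|m IHm] B.
  rewrite graph_laplacian0 expr0 mul1r; apply: eq_bigr => i _.
  by rewrite !harmonic_ext_q.
rewrite -{1}(F_fixed j) graph_laplacian_F; last 2 first.
- exact: SG_q.
- by move=> i /q_inj.
rewrite (graph_laplacian_eq (v := harmonic_ext (A 0 j *m B)) _ (SG_q j));
  last by move=> y Sy /=; exact: harmonic_ext_F.
by rewrite IHm A0_flux mulrA -exprSr.
Qed.

(** At a junction point the two corner contributions carry the same power of 3/5 and cancel; any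
    other point is handled inside its cell by induction. *)
Lemma graph_laplacian_harmonic_ext m B x : V q m x -> ~ V q 0 x ->
  graph_laplacian q SG m (harmonic_ext B) x = 0.
Proof.
elim: m B x => [//|m IHm] B x /VS[i [y [Vy ->]]] nV.
have Sy := V_SG Vy.
have ext l z : SG z ->
    graph_laplacian q SG m (harmonic_ext B \o F q l) z =
    graph_laplacian q SG m (harmonic_ext (A 0 l *m B)) z.
  by move=> Sz; apply: graph_laplacian_eq => // t St; exact: harmonic_ext_F.
have [/V0E[j yj]|nVy] := pselect (V q 0 y).
  have ij : i <> j.
    by move=> ij; apply: nV; rewrite yj ij F_fixed; exact: (V_q 0).
  rewrite yj graph_laplacian_junction// !ext; [|exact: SG_q..].
  by rewrite !graph_laplacian_corner -mulrDr A0_flux_balance// mulr0.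
rewrite graph_laplacian_F// => [|j yj]; last first.
  by case: nVy; rewrite yj; exact: (V_q 0).
by rewrite ext// IHm.
Qed.

Lemma harmonic_harmonic_ext B : Defs.harmonic q SG (harmonic_ext B).
Proof.
exists (fun=> 0) => //; split.
- exact: harmonic_ext_continuous.
- by apply: continuous_subspaceT => x; exact: (@cvg_cst _ 0 _ (nbhs x) _).
- move=> e e0; exists 0%N => m _ x [Vx nVx].
  by rewrite graph_laplacian_harmonic_ext// mulr0 subrr normr0.
Qed.

Lemma values_harmonic_ext B w n :
  values q (harmonic_ext B) (mkseq w n) =
  decimation_product (fun=> 0) w 0 n *m B.
Proof.
(* The induction peels off the first letter, which changes the boundary values, so they are
   generalized. *)
suff h v B' i : harmonic_ext B' (Fw q v (q i)) =
    (\prod_(a <- rev v) A 0 a *m B') i ord0.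
  apply/matrixP => i c; rewrite ord1 mxE h /mkseq -map_rev big_map.
  by rewrite /decimation_product /index_iota subn0.
elim: v B' => [|a v IHv] B'; first by rewrite big_nil mul1mx harmonic_ext_q.
rewrite /= -/(Fw q v (q i)) harmonic_ext_F; last by apply: Fw_SG; exact: SG_q.
by rewrite IHv rev_cons -cats1 big_cat big_seq1 -mulmxE mulmxA.
Qed.
End Gasket.

(** * The harmonic tangent *)

Lemma decimation_product0_inv (R : realType) (w : nat -> 'I_3) (n : nat) :
  decimation_product (fun=> 0 : R) w 0 n *m
  \prod_(0 <= j < n) invmx (A 0 (w j)) = 1%:M.
Proof.
elim: n => [|n IHn].
  by rewrite decimation_product_refl big_geq// mul1mx.
rewrite decimation_productS// big_nat_recr//= -mulmxE mulmxA.
by rewrite -(mulmxA (A 0 (w n))) IHn mulmx1 mulmxV ?A0_unit.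
Qed.

Lemma values_decimation (R : realType) (q : 'I_3 -> 'rV[R]_2) (m0 : nat)
    (lam : nat -> R) (u : 'rV[R]_2 -> R) (w : nat -> 'I_3) (m : nat) :
  spectral_decimation q m0 lam u -> (m0 <= m)%N ->
  values q u (mkseq w m) =
  decimation_product lam w m0 m *m values q u (mkseq w m0).
Proof.
move=> hdec; rewrite leq_eqVlt => /orP[/eqP <-|m0m].
  (* The decimation hypothesis starts at m0 + 1; at m0 the product is empty. *)
  by rewrite decimation_product_refl mul1mx.
rewrite (hdec _ m0m) ?size_mkseq//.
rewrite (@eq_decimation_product _ _ _ w); last by move=> j jm; rewrite nth_mkseq.
by rewrite -map_take take_iota (minn_idPl (ltnW m0m)).
Qed.

(* [hlamk] only makes the divisions by lambda_k in M_0 meaningful; under the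
   other hypotheses it is equivalent to lambda <> 0. *)
Theorem theorem2p3 (R : realType) (q : 'I_3 -> 'rV[R]_2)
  (hq : equilateral q) (SG : set 'rV[R]_2) (hSG : is_SG q SG)
  (w : nat -> 'I_3) (k0 : nat) (hw : forall j, (k0 <= j)%N -> w j = ord0)
  (lambda : R) (u : 'rV[R]_2 -> R) (hu : eigen_equation q SG lambda u)
  (m0 : nat) (lam : nat -> R) (hlam : associated m0 lam lambda)
  (hdec : spectral_decimation q m0 lam u)
  (hforb : forall m, (m0 < m)%N -> [/\ lam m <> 2, lam m <> 5 & lam m <> 6])
  (k : nat) (hk : k = maxn k0 m0) (hlamk : lam k <> 0) :
  is_harmonic_tangent q SG u w
    ((\prod_(0 <= j < k) invmx (A 0 (w j))) *m M0 lambda lam k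
     *m decimation_product lam w m0 k *m values q u (mkseq w m0)).
Proof.
have m0k : (m0 <= k)%N by rewrite hk leq_maxr.
have wk j : (k <= j)%N -> w j = ord0.
  by move=> kj; apply: hw; apply: leq_trans kj; rewrite hk leq_maxl.
have hforb2 m : (m0 < m)%N -> lam m <> 2 /\ lam m <> 5 by case/hforb.
(* The boundary values of H_{[w]_m} u. *)
pose B m := \prod_(0 <= j < m) invmx (A 0 (w j)) *m values q u (mkseq w m).
exists (fun m => harmonic_ext q SG (B m)); split=> [m|].
  split=> [|i]; first exact: harmonic_harmonic_ext.
  have /matrixP/(_ i ord0) := values_harmonic_ext hq hSG (B m) w m.
  by rewrite mulmxA decimation_product0_inv mul1mx !mxE.
have -> : (fun m => values q (harmonic_ext q SG (B m)) [::]) = B.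
  by apply/funext => m; apply/matrixP => i c; rewrite ord1 mxE harmonic_ext_q.
rewrite -(@cvg_shiftn k).
(* Both products are cut at level k; beyond it all letters are 0, and only the middle factor depends
   on [n]. *)
have -> : (fun n => B (n + k)%N) = (fun n =>
    \prod_(0 <= j < k) invmx (A 0 (w j)) *m
    (invmx (A 0 ord0) ^+ n *m decimation_product lam w k (k + n)%N) *m
    decimation_product lam w m0 k *m values q u (mkseq w m0)).
  apply/funext => n; rewrite /B addnC.
  rewrite (values_decimation w hdec (leq_trans m0k (leq_addr n k))).
  rewrite (decimation_product_cat _ _ m0k (leq_addr n k)) !mulmxA.
  congr (_ *m _ *m _ *m _); rewrite (@big_cat_nat _ _ _ k)//= ?leq_addr//.
  rewrite mulmxE; congr (_ * _).
  rewrite (eq_big_nat _ _ (F2 := fun=> invmx (A 0 ord0))); last first.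
    by move=> j /andP[kj _]; rewrite wk.
  by rewrite prodr_const_nat addKn.
apply: cvg_mulmx; last exact: cvg_cst.
apply: cvg_mulmx; last exact: cvg_cst.
apply: cvg_mulmx; first exact: cvg_cst.
exact: (cvg_tangent_mx hlam m0k hforb2 hlamk wk).
Qed.
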